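(* Let $\mathcal{P}=C_1\cup\dots\cup C_w$ be a disjoint union of chains with $|C_i|=\ell_i$ (no relations between distinct chains). Then the linear extension diameter of the downset lattice $\mathcal{D}_\mathcal{P}$ equals \[\frac14\left(\Big(\prod_{i=1}^{w}(\ell_i+1)\Big)^2-\sum_{k=1}^{w}(\ell_k+1)\ell_k\prod_{i\neq k}(\ell_i+1)-\prod_{i=1}^{w}(\ell_i+1)\right).\]
   Context: $\mathcal{D}_\mathcal{P}$ is the poset of downsets of $\mathcal{P}$ ordered by inclusion. The linear extension diameter of a finite poset is the maximum, over pairs of its linear extensions, of the number of unordered pairs of elements appearing in different orders in the two. *)

(* Defs.v *)
From HB Require Import structures.
From mathcomp Require Import all_boot all_order all_algebra.

Set Implicit Arguments.
Unset Strict Implicit.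
Unset Printing Implicit Defensive.

Import Order.TTheory.

Section Downsets.
Context (d : Order.disp_t) (P : finPOrderType d).
Local Open Scope order_scope.

Definition is_downset (A : {set P}) : bool :=
  [forall x in A, forall y, (y <= x) ==> (y \in A)].

Record downset : Type :=
  Downset { downset_val :> {set P}; _ : is_downset downset_val }.

HB.instance Definition _ := [isSub for downset_val].
HB.instance Definition _ := [Finite of downset by <:].

Definition downset_le (A B : downset) : bool :=
  downset_val A \subset downset_val B.

Fact downset_le_refl : reflexive downset_le.
Proof. by move=> A; apply: subxx. Qed.

Fact downset_le_anti : antisymmetric downset_le.
Proof. by move=> A B AB; apply/val_inj/eqP; rewrite eqEsubset. Qed.

Fact downset_le_trans : transitive downset_le.
Proof. by move=> B A C; apply: subset_trans. Qed.

Fact downset_display : Order.disp_t. Proof. exact: Order.Disp tt tt. Qed.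

HB.instance Definition _ := Order.Le_isPOrder.Build downset_display downset
  downset_le_refl downset_le_anti downset_le_trans.

Lemma downset_leE (A B : downset) :
  (A <= B) = (downset_val A \subset downset_val B).
Proof. by []. Qed.

End Downsets.

Section LinearExtensions.
Context (d : Order.disp_t) (Q : finPOrderType d).

(* (x, y) \in L means that x is weakly before y; reflexivity of L follows from
   totality (and from containing the order of Q). Relations are represented by
   sets of pairs so that they form a finite type. *)
Definition linear_extension (L : {set Q * Q}) : bool :=
  [&& [forall x, forall y, ((x, y) \in L) || ((y, x) \in L)],
      [forall x, forall y, ((x, y) \in L) && ((y, x) \in L) ==> (x == y)],
      [forall x, forall y, forall z,
         ((x, y) \in L) && ((y, z) \in L) ==> ((x, z) \in L)]
    & [forall x, forall y, (x <= y)%O ==> ((x, y) \in L)]].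

Definition reversed_pairs (L1 L2 : {set Q * Q}) : {set {set Q}} :=
  [set [set x; y] | x in Q, y in Q
     & [&& x != y, (x, y) \in L1 & (y, x) \in L2]].

(* Q always has a linear extension, so the maximum is not over an empty set. *)
Definition linear_extension_diameter : nat :=
  \max_(L1 : {set Q * Q} | linear_extension L1)
    \max_(L2 : {set Q * Q} | linear_extension L2) #|reversed_pairs L1 L2|.

End LinearExtensions.

Arguments linear_extension_diameter {d} Q.

(* Main.v *)
Require Import Defs.
From HB Require Import structures.
From mathcomp Require Import all_boot all_order all_algebra.
From mathcomp Require Import ring zify.

Set Implicit Arguments.
Unset Strict Implicit.
Unset Printing Implicit Defensive.

Import Order.TTheory GRing.Theory Num.Theory.
Local Open Scope ring_scope.

(** The lattice of downsets is the product of the chains [0 .. l i], with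
    [N = \prod_i (l i).+1] elements.  For linear extensions [L1], [L2] let
    [s1], [s2] be the signs with which they order a pair; then
    [4 * #reversed = N^2 - N - \sum_(x, y) s1 (x, y) * s2 (x, y)].  Pairs that
    differ in one coordinate are comparable and contribute [N * \sum_k l k] to
    the sum.  The pairs that differ in at least two coordinates contribute a
    nonnegative amount: exchanging the k-th coordinates of the two members
    changes [s1] and [s2] in the same direction, so averaging over this exchange
    can only decrease [\sum s1 * s2] (as in the Harris-Kleitman inequality), and
    after averaging over all coordinates both signs vanish, being antisymmetric.
    The contribution is zero for the lexicographic and the reverse
    lexicographic order. *)

(** * Exchanging coordinates between two points of a product of chains *)

Section ChainProduct.
Variables (w : nat) (l : 'I_w -> nat).

Definition chain_prod : Type := {dffun forall i : 'I_w, 'I_(l i).+1}.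
HB.instance Definition _ := Finite.on chain_prod.

Local Notation X := chain_prod.
Implicit Types (x y : X) (z : X * X) (f g : X * X -> int) (i j k : 'I_w).

Definition swap k z : X * X :=
  ([ffun i => if i == k then z.2 i else z.1 i],
   [ffun i => if i == k then z.1 i else z.2 i]).

Definition flip z : X * X := (z.2, z.1).

Definition diff z : {set 'I_w} := [set i | z.1 i != z.2 i].

Lemma swap1E k z i : (swap k z).1 i = if i == k then z.2 i else z.1 i.
Proof. by rewrite ffunE. Qed.

Lemma swap2E k z i : (swap k z).2 i = if i == k then z.1 i else z.2 i.
Proof. by rewrite ffunE. Qed.

Lemma pair_eqP z z' :
  (forall i, z.1 i = z'.1 i) -> (forall i, z.2 i = z'.2 i) -> z = z'.
Proof.
by case: z z' => [x y] [x' y'] /= h1 h2; congr (_, _); apply/ffunP.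
Qed.

Lemma swapK k : involutive (swap k).
Proof.
by move=> z; apply: pair_eqP => i; rewrite !(swap1E, swap2E); case: eqP.
Qed.

Lemma swapC j k z : swap j (swap k z) = swap k (swap j z).
Proof.
by apply: pair_eqP => i; rewrite !(swap1E, swap2E); do 2 case: eqP.
Qed.

Lemma swap_flip k z : swap k (flip z) = flip (swap k z).
Proof. by apply: pair_eqP => i; rewrite !(swap1E, swap2E). Qed.

Lemma diff_swap k z : diff (swap k z) = diff z.
Proof.
by apply/setP => i; rewrite !inE swap1E swap2E; case: (i == k); rewrite // eq_sym.
Qed.

(** Each index occurs exactly once in the enumeration. Hence a function invariant under every
    [swap k] is invariant under [flip]. *)
Lemma foldr_swap_enum z : foldr swap z (enum 'I_w) = flip z.
Proof.
have H s : uniq s -> forall i,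
    ((foldr swap z s).1 i = if i \in s then z.2 i else z.1 i)
  * ((foldr swap z s).2 i = if i \in s then z.1 i else z.2 i).
  elim: s => [|k s IH] //= /andP[ks us] i; rewrite swap1E swap2E !IH // inE.
  by case: (eqVneq i k) => [->|_]; rewrite ?(negPf ks).
by apply: pair_eqP => i; rewrite H ?enum_uniq // mem_enum.
Qed.

(* [f z] measures how strongly [z.1] precedes [z.2]. *)
Definition swap_monotone f :=
  forall k z, (z.1 k <= z.2 k)%N -> f (swap k z) <= f z.

Definition symmetrize k f z := f z + f (swap k z).

(** For [j = k] the symmetrized function is invariant under the exchange. For [j != k] the exchanges
    commute and [swap k] leaves the j-th coordinates alone, so neither summand increases. *)
Lemma symmetrize_monotone k f :
  swap_monotone f -> swap_monotone (symmetrize k f).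
Proof.
move=> mf j z lez; rewrite /symmetrize; case: (eqVneq j k) => [->|jk].
  by rewrite swapK addrC.
by rewrite [swap k _]swapC lerD ?mf // swap1E swap2E (negPf jk).
Qed.

(** Which point has the larger k-th coordinate decides the sign of both differences at once. *)
Lemma swap_monotone_mul k f g z : swap_monotone f -> swap_monotone g ->
  0 <= (f z - f (swap k z)) * (g z - g (swap k z)).
Proof.
move=> mf mg; case: (leqP (z.1 k) (z.2 k)) => [le|/ltnW ge].
  by rewrite mulr_ge0 // subr_ge0 ?mf ?mg.
have D h : swap_monotone h -> h z <= h (swap k z).
  by move=> mh; rewrite -{1}(swapK k z) mh // swap1E swap2E eqxx.
by apply: mulr_le0; rewrite subr_le0 D.
Qed.

(** * A correlation inequality obtained by repeated symmetrization *)

Section InvariantDomain.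
Variable T : pred (X * X).
Hypothesis T_swap : forall k z, T (swap k z) = T z.

Lemma sum_swap k (F : X * X -> int) :
  \sum_(z | T z) F z = \sum_(z | T z) F (swap k z).
Proof.
rewrite (reindex_inj (can_inj (swapK k))) /=.
by apply: eq_bigl => z; rewrite T_swap.
Qed.

(** The pointwise bound (a + a')(b + b') <= 2(ab + a'b') amounts to (a - a')(b - b') >= 0.
    Invariance of [T] gives ab and a'b' equal sums, whence the factor 4. *)
Lemma sum_symmetrize k f g : swap_monotone f -> swap_monotone g ->
  \sum_(z | T z) symmetrize k f z * symmetrize k g z
    <= 4 * \sum_(z | T z) f z * g z.
Proof.
move=> mf mg.
have -> : 4 * (\sum_(z | T z) f z * g z) =
    \sum_(z | T z) 2 * (f z * g z + f (swap k z) * g (swap k z)).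
  by rewrite -mulr_sumr big_split /= -(sum_swap k (fun z => f z * g z)); ring.
apply: ler_sum => z _; rewrite /symmetrize -subr_ge0.
have := swap_monotone_mul k z mf mg; lia.
Qed.

Lemma sum_symmetrize_seq ks f g : swap_monotone f -> swap_monotone g ->
  \sum_(z | T z) foldr symmetrize f ks z * foldr symmetrize g ks z
    <= 4 ^+ size ks * \sum_(z | T z) f z * g z.
Proof.
have M h : swap_monotone h -> forall s, swap_monotone (foldr symmetrize h s).
  by move=> mh; elim=> //= k s; apply: symmetrize_monotone.
move=> mf mg; elim: ks => [|k s IH] /=; first by rewrite expr0 mul1r.
apply: le_trans (sum_symmetrize k (M f mf s) (M g mg s)) _.
by rewrite exprS -mulrA ler_wpM2l.
Qed.

Lemma foldr_symmetrize_swap ks f k z : k \in ks ->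
  foldr symmetrize f ks (swap k z) = foldr symmetrize f ks z.
Proof.
elim: ks z => //= j s IH z; rewrite inE /symmetrize.
case: (eqVneq k j) => [->|_] /= ks; first by rewrite swapK addrC.
by rewrite [swap j _]swapC !IH.
Qed.

Lemma foldr_symmetrize_flip ks f : (forall z, f (flip z) = - f z) ->
  forall z, foldr symmetrize f ks (flip z) = - foldr symmetrize f ks z.
Proof.
move=> ff; elim: ks => //= k s IH z.
by rewrite /symmetrize swap_flip !IH opprD.
Qed.

(** After symmetrizing in every coordinate the function is invariant under [flip], yet still
    antisymmetric under it. *)
Lemma full_symmetrize_eq0 f z : (forall z, f (flip z) = - f z) ->
  foldr symmetrize f (enum 'I_w) z = 0.
Proof.
move=> ff; set F := foldr _ _ _.
suff: F (flip z) = F z by rewrite {1}/F foldr_symmetrize_flip // -/F; lia.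
rewrite -foldr_swap_enum; elim: (enum _) => //= k s IH.
by rewrite /F foldr_symmetrize_swap ?mem_enum.
Qed.

(* A form of the Harris-Kleitman correlation inequality. *)
Lemma sum_antisymmetric_ge0 f g :
    swap_monotone f -> swap_monotone g -> (forall z, f (flip z) = - f z) ->
  0 <= \sum_(z | T z) f z * g z.
Proof.
move=> mf mg ff.
have := sum_symmetrize_seq (enum 'I_w) mf mg.
rewrite big1 => [|z _]; last by rewrite full_symmetrize_eq0 // mul0r.
by rewrite pmulr_rge0 // exprn_gt0.
Qed.

End InvariantDomain.

(** * Counting the pairs of points that differ in exactly one coordinate *)

Lemma card_chain_prod : #|{: X}| = (\prod_i (l i).+1)%N.
Proof.
rewrite card_dep_ffun foldrE big_map big_enum.
by apply: eq_bigr => i _; rewrite card_ord.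
Qed.

Lemma card_diff_set1 x k : #|[set y : X | diff (x, y) == [set k]]| = l k.
Proof.
(* The k-th coordinate must avoid [x k], which leaves [l k] of [(l k).+1] values; every other
   coordinate is forced. *)
pose F i : pred 'I_(l i).+1 := if i == k then predC1 (x i) else pred1 (x i).
have -> : #|[set y : X | diff (x, y) == [set k]]| =
    #|(family F : simpl_pred {dffun forall i : 'I_w, 'I_(l i).+1})|.
  apply: eq_card => y; rewrite inE; apply/eqP/familyP => [/setP h i|h].
    have := h i; rewrite !inE /F /= unfold_in.
    by case: ifP => _ /=; [move=> hi|move/negbFE]; rewrite eq_sym.
  apply/setP => i; have := h i; rewrite !inE /F /= unfold_in [x i == _]eq_sym.
  by case: (i == k) => //= ->.
rewrite card_family foldrE big_map big_enum /= (bigD1 k) //= big1 => [|i ik].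
  by rewrite muln1 /F eqxx cardC1 card_ord.
by rewrite /F (negPf ik) card1.
Qed.

Lemma card_pairs_diff1 :
  #|[set z | #|diff z| == 1%N]| = (\sum_k (\prod_i (l i).+1) * l k)%N.
Proof.
rewrite -sum1_card -card_chain_prod.
(* At most one [k] satisfies [diff z == [set k]], so the inner sum is the indicator of
   [#|diff z| == 1]. *)
transitivity (\sum_(z : X * X) \sum_k (diff z == [set k]))%N.
  rewrite big_mkcond /=; apply: eq_bigr => z _; rewrite inE.
  case: cards1P => [[k ->]|h].
    rewrite (bigD1 k) //= eqxx big1 // => j jk.
    by rewrite eqEcard !cards1 sub1set inE eq_sym (negPf jk).
  by rewrite big1 // => k _; case: eqP => // e; case: h; exists k.
rewrite exchange_big; apply: eq_bigr => k _ /=.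
rewrite -(pair_bigA _ (fun x y => nat_of_bool (diff (x, y) == [set k]))) /=.
rewrite -sum_nat_const; apply: eq_bigr => x _.
rewrite -(card_diff_set1 x k) -sum1_card [RHS]big_mkcond /=.
by apply: eq_bigr => y _; rewrite inE; case: eqP.
Qed.


(** * The componentwise order and the lexicographic orders that extend it *)

Definition chain_prod_le x y := [forall i, (x i <= y i)%N].

Section Lexicographic.
Variable r : 'I_w -> nat.
Hypothesis r_inj : injective r.

(* Lexicographic comparison, the coordinates being read by increasing [r]. *)
Definition lex_le x y :=
  [forall k, [forall i, (r i < r k)%N ==> (x i == y i)] ==> (x k <= y k)%N].

(** A relation rather than a function, since equal points have no first differing coordinate. *)
Definition first_diff z k :=
  (k \in diff z) && [forall i, (r i < r k)%N ==> (i \notin diff z)].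

Lemma first_diffP z k :
  reflect (k \in diff z /\ forall i, (r i < r k)%N -> z.1 i = z.2 i)
          (first_diff z k).
Proof.
apply: (iffP andP) => -[kz h]; split=> //.
  move=> i ik; move/forallP/(_ i)/implyP/(_ ik): h.
  by rewrite inE negbK => /eqP.
by apply/forallP => i; apply/implyP => /h e; rewrite inE e eqxx.
Qed.

Lemma first_diff_swap j z k : first_diff (swap j z) k = first_diff z k.
Proof. by rewrite /first_diff diff_swap. Qed.

Lemma first_diff_flip z k : first_diff (flip z) k = first_diff z k.
Proof.
rewrite /first_diff; have -> // : diff (flip z) = diff z.
by apply/setP => i; rewrite !inE eq_sym.
Qed.

Lemma first_diff_ex z : diff z != set0 -> exists k, first_diff z k.
Proof.
case/set0Pn => k0 k0z; case: (arg_minnP r k0z) => k kz kmin; exists k.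
apply/andP; split=> //; apply/forallP => i; apply/implyP => ik.
by apply/negP => /kmin; rewrite leqNgt ik.
Qed.

Lemma diff_eq0 z : diff z = set0 -> z.1 = z.2.
Proof.
move=> /setP z0; apply/ffunP => i; apply/eqP.
by have := z0 i; rewrite !inE => /negbFE.
Qed.

(** Coordinates of smaller rank agree, and for those of larger rank the premise in [lex_le] fails at
    [k]; only the condition at [k] remains. *)
Lemma lex_le_first z k : first_diff z k -> lex_le z.1 z.2 = (z.1 k <= z.2 k)%N.
Proof.
case/first_diffP => kz h; apply/forallP/idP => [/(_ k)/implyP|lek j].
  by apply; apply/forallP => i; apply/implyP => /h ->.
apply/implyP => /forallP hj.
case: (ltngtP (r j) (r k)) => [/h -> //|kj|/r_inj->//].
by move: kz; rewrite inE; move: (hj k); rewrite kj => /= ->.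
Qed.

Lemma lex_le_pointwise x y : chain_prod_le x y -> lex_le x y.
Proof. by move=> /forallP h; apply/forallP => k; apply/implyP. Qed.

Lemma lex_le_total x y : lex_le x y || lex_le y x.
Proof.
have [/diff_eq0/=->|] := eqVneq (diff (x, y)) set0.
  by rewrite lex_le_pointwise //; apply/forallP.
case/first_diff_ex => k xyk; have yxk := xyk; rewrite -first_diff_flip in yxk.
by rewrite (lex_le_first xyk) (lex_le_first yxk) leq_total.
Qed.

Lemma lex_le_anti x y : lex_le x y -> lex_le y x -> x = y.
Proof.
have [/diff_eq0/= //|] := eqVneq (diff (x, y)) set0.
case/first_diff_ex => k xyk; have yxk := xyk; rewrite -first_diff_flip in yxk.
rewrite (lex_le_first xyk) (lex_le_first yxk) /= => le1 le2.
by case/andP: xyk; rewrite inE /= -val_eqE eqn_leq le1 le2.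
Qed.

Lemma lex_le_trans x y t : lex_le x y -> lex_le y t -> lex_le x t.
Proof.
move=> /forallP xy /forallP yt; apply/forallP => k; apply/implyP => /forallP xt.
(* Strong induction on the rank: once all earlier coordinates agree, [x i <= y i <= t i = x i]. *)
have E n i : (r i < n)%N -> (n <= r k)%N -> x i = y i.
  elim: n i => // n IH i; rewrite ltnS => i_n nk.
  have ik : (r i < r k)%N := leq_ltn_trans i_n nk.
  have xyi j : (r j < r i)%N -> x j = y j.
    by move=> ji; apply: IH (ltnW nk); apply: leq_trans ji i_n.
  have xti j : (r j < r k)%N -> x j = t j.
    by move=> jk; move: (xt j); rewrite jk => /eqP.
  apply/val_inj/eqP; rewrite eqn_leq; apply/andP; split.
    by apply: (implyP (xy i)); apply/forallP => j; apply/implyP => /xyi ->.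
  rewrite (xti i ik); apply: (implyP (yt i)).
  apply/forallP => j; apply/implyP => ji.
  by rewrite -(xyi j ji) -(xti j (ltn_trans ji ik)).
apply: (@leq_trans (y k)).
  by apply: (implyP (xy k)); apply/forallP => j; apply/implyP => /E ->.
apply: (implyP (yt k)); apply/forallP => j; apply/implyP => jk.
by rewrite -(E _ _ jk (leqnn _)); move: (xt j); rewrite jk.
Qed.

Definition lex_sign z : int := (lex_le z.1 z.2)%:Z - (lex_le z.2 z.1)%:Z.

Lemma lex_sign_first z k : first_diff z k ->
  lex_sign z = (z.1 k <= z.2 k)%N%:Z - (z.2 k <= z.1 k)%N%:Z.
Proof.
move=> zk; have fk := zk; rewrite -first_diff_flip in fk.
by rewrite /lex_sign (lex_le_first zk) (lex_le_first fk).
Qed.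

Lemma lex_sign_swap_first z k : first_diff z k ->
  lex_sign (swap k z) = - lex_sign z.
Proof.
move=> zk; have sk := zk; rewrite -(first_diff_swap k) in sk.
by rewrite (lex_sign_first zk) (lex_sign_first sk) swap1E swap2E eqxx opprB.
Qed.

Lemma lex_sign_swap_other z j k : first_diff z k -> j != k ->
  lex_sign (swap j z) = lex_sign z.
Proof.
move=> zk jk; have sk := zk; rewrite -(first_diff_swap j) in sk.
rewrite (lex_sign_first zk) (lex_sign_first sk) swap1E swap2E.
by rewrite eq_sym (negPf jk).
Qed.

Lemma first_diff_inj z j k : first_diff z j -> first_diff z k -> j = k.
Proof.
move=> /first_diffP[jz hj] /first_diffP[kz hk]; apply: r_inj.
move: jz kz; rewrite !inE.
by case: (ltngtP (r j) (r k)) => [/hk->|/hj->|//]; rewrite eqxx.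
Qed.

End Lexicographic.

(** The truncated subtraction loses nothing because [i < w]. *)
Lemma rev_rank_inj : injective (fun i : 'I_w => (w - i)%N).
Proof.
move=> i j e; apply/val_inj => /=.
by have := ltn_ord i; have := ltn_ord j; lia.
Qed.

Local Notation rank := (@nat_of_ord w).
Local Notation rev_rank := (fun i : 'I_w => (w - i)%N).

(* Swapping a pair at its first differing coordinate reverses its
   lexicographic order; when another coordinate differs, the last differing
   coordinate is untouched, and so is the reverse lexicographic order. *)
Lemma sum_lex_sign_eq0 :
  \sum_(z | (1 < #|diff z|)%N) lex_sign rank z * lex_sign rev_rank z = 0.
Proof.
set F := fun z => _; set S := \sum_(z | _) _.
(* A sign-reversing involution on the domain of the sum. The default [z] is taken only when the two
   points are equal, and such pairs are excluded from the sum. *)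
pose h z := if [pick k | first_diff rank z k] is Some k then swap k z else z.
have hK : involutive h.
  move=> z; rewrite {2}/h; case: pickP => [k zk|z0]; last first.
    by rewrite /h; case: pickP => // k; rewrite z0.
  rewrite /h; case: pickP => [j|/(_ k)]; last by rewrite first_diff_swap zk.
  rewrite first_diff_swap => /first_diff_inj-/(_ val_inj k zk) ->.
  by rewrite swapK.
suff : S = - S by lia.
rewrite {1}/S (reindex_inj (can_inj hK)) /= -sumrN.
apply: eq_big => [z|z].
  by rewrite /h; case: pickP => // k; rewrite diff_swap.
rewrite /h; case: pickP => [k zk|z0]; last first.
  move=> z2; have /first_diff_ex-/(_ rank)[k] : diff z != set0.
    by rewrite -card_gt0 ltnW.
  by rewrite z0.
rewrite diff_swap => z2; rewrite (lex_sign_swap_first val_inj zk).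
have /first_diff_ex-/(_ rev_rank)[m zm] : diff z != set0.
  by rewrite -card_gt0 ltnW.
rewrite (lex_sign_swap_other rev_rank_inj zm) ?mulNr //.
(* If the first and the last differing coordinates coincide, then [diff z] is contained in a
   singleton. *)
apply: contraTneq z2 => km; rewrite -leqNgt -{m}km in zm *.
case/first_diffP: zk zm => kz hk /first_diffP[_ hk'].
rewrite -(cards1 k); apply/subset_leq_card/subsetP => i; rewrite !inE.
case: (ltngtP i k) => [/hk->|ki|/val_inj->]; rewrite ?eqxx //.
by rewrite hk' ?eqxx //; have := ltn_ord i; lia.
Qed.

End ChainProduct.

(** * The number of reversed pairs as a sum of products of signs *)

Section ReversedPairs.
Context (d : Order.disp_t) (Q : finPOrderType d).
Implicit Types (L : {set Q * Q}) (a b c : Q).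

Lemma linear_extensionP L :
  reflect [/\ forall a b, ((a, b) \in L) || ((b, a) \in L),
              forall a b, (a, b) \in L -> (b, a) \in L -> a = b,
              forall a b c, (a, b) \in L -> (b, c) \in L -> (a, c) \in L
            & forall a b, (a <= b)%O -> (a, b) \in L]
          (linear_extension L).
Proof.
apply: (iffP and4P) => -[h1 h2 h3 h4]; split.
- by move=> a b; apply: (forallP (forallP h1 a)).
- move=> a b ab ba; apply/eqP; apply: (implyP (forallP (forallP h2 a) b)).
  by rewrite ab.
- move=> a b c ab bc.
  by apply: (implyP (forallP (forallP (forallP h3 a) b) c)); rewrite ab.
- by move=> a b; apply: (implyP (forallP (forallP h4 a) b)).
- by apply/forallP => a; apply/forallP.
- apply/forallP => a; apply/forallP => b; apply/implyP => /andP[ab ba].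
  by rewrite (h2 a b).
- do 3 (apply/forallP => ?); apply/implyP => /andP[]; exact: h3.
- do 2 (apply/forallP => ?); apply/implyP; exact: h4.
Qed.

Definition order_sign L (p : Q * Q) : int :=
  (p \in L)%:Z - ((p.2, p.1) \in L)%:Z.

(** By antisymmetry of [L1], a reversed unordered pair has exactly one orientation that agrees with
    [L1]. *)
Lemma card_reversed_pairs L1 L2 : linear_extension L1 ->
  #|reversed_pairs L1 L2|
    = #|[set p : Q * Q | [&& p.1 != p.2, p \in L1 & (p.2, p.1) \in L2]]|.
Proof.
case/linear_extensionP => _ anti _ _.
rewrite -[RHS](card_in_imset (f := fun p => [set p.1; p.2])).
  congr #|pred_of_set _|; apply/setP => A; apply/imset2P/imsetP.
    by case=> a b _; rewrite inE => /= h ->; exists (a, b); rewrite ?inE.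
  by case=> -[a b]; rewrite inE => /= h ->; exists a b; rewrite ?inE.
move=> [a b] [a' b'] /=; rewrite !inE /= => /and3P[ab Lab _] /and3P[_ Lab' _].
move=> /setP e; have := e a; have := e b; rewrite !inE !eqxx orbT /=.
move=> /esym eb /esym /orP[/eqP ea|/eqP ea]; subst.
  by move: eb; rewrite eq_sym (negPf ab) => /eqP ->.
move: eb; rewrite [b == b']eq_sym (negPf ab) orbF => /eqP eb; subst.
by rewrite (anti _ _ Lab Lab').
Qed.

(** Off the diagonal, 1 minus the product of signs is 2 on reversed pairs and 0 elsewhere; each
    unordered pair is met in two orientations, hence 4. On the diagonal both signs vanish. *)
Lemma reversed_pairs_order_sign L1 L2 :
    linear_extension L1 -> linear_extension L2 ->
  4 * #|reversed_pairs L1 L2|%:Z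
    = #|Q|%:Z ^+ 2 - #|Q|%:Z - \sum_p order_sign L1 p * order_sign L2 p.
Proof.
move=> L1P L2P; rewrite card_reversed_pairs //; set S := [set p | _].
pose inS p : int := (p \in S)%:Z.
have sumS : \sum_p inS p = #|S|%:Z.
  rewrite -[RHS]natz -sum1_card natr_sum [RHS]big_mkcond.
  by apply: eq_bigr => p _; rewrite /inS; case: ifP.
have sumS' : \sum_p inS (p.2, p.1) = #|S|%:Z.
  rewrite -sumS [RHS](reindex_inj (h := fun p : Q * Q => (p.2, p.1))) //.
  by move=> [a b] [a' b'] [-> ->].
have sumD : \sum_(p : Q * Q) (p.1 == p.2)%:Z = #|Q|%:Z.
  rewrite -(pair_bigA _ (fun a b => (a == b)%:Z)) /=.
  rewrite -[RHS]natz -sum1_card natr_sum; apply: eq_bigr => a _.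
  by rewrite (bigD1 a) //= eqxx big1 // => b; rewrite eq_sym => /negPf ->.
have -> : #|Q|%:Z ^+ 2 = \sum_(p : Q * Q) 1.
  by rewrite sumr_const card_prod natz PoszM expr2.
rewrite -{}sumD -sumrB -sumrB.
(* One 2 is assigned to each orientation, so that the identity can be checked pair by pair. *)
rewrite -[4]/(2 + 2 : int) mulrDl -{1}sumS -sumS' !mulr_sumr -big_split /=.
apply: eq_bigr => -[a b] _; rewrite /inS /order_sign !inE /=.
case/linear_extensionP: L1P => tot1 anti1 _ _.
case/linear_extensionP: L2P => tot2 anti2 _ _.
case: (eqVneq a b) => [<-|ab] /=; first by rewrite !subrr.
have := tot1 a b; have := tot2 a b; have := anti1 a b; have := anti2 a b.
move: ((a, b) \in L1) ((b, a) \in L1) ((a, b) \in L2) ((b, a) \in L2).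
case=> [] [] [] [] //= a2 a1 _ _;
  by case/eqP: ab; first [exact: a1 | exact: a2].
Qed.

End ReversedPairs.

(** * The diameter of a poset isomorphic to a product of chains *)

Section Diameter.
Context (d : Order.disp_t) (Q : finPOrderType d) (w : nat) (l : 'I_w -> nat).
Variables (phi : Q -> chain_prod l) (psi : chain_prod l -> Q).
Hypotheses (phiK : cancel phi psi) (psiK : cancel psi phi).
Hypothesis phi_le : forall a b, (a <= b)%O = chain_prod_le (phi a) (phi b).

Let N := (\prod_(i < w) (l i).+1)%N.
Let sign (L : {set Q * Q}) z := order_sign L (psi z.1, psi z.2).

Lemma order_sign_flip L z : sign L (flip z) = - sign L z.
Proof. by rewrite /sign /order_sign opprB. Qed.

(** The exchange raises the first point and lowers the second. If [L] still puts the raised point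
    before the lowered one, transitivity puts [z.1] before [z.2]. *)
Lemma order_sign_monotone L : linear_extension L -> swap_monotone (sign L).
Proof.
case/linear_extensionP => tot anti tr ext k z lez.
have le1 : (psi z.1 <= psi (swap k z).1)%O.
  rewrite phi_le !psiK; apply/forallP => i; rewrite swap1E.
  by case: eqP => [->|].
have le2 : (psi (swap k z).2 <= psi z.2)%O.
  rewrite phi_le !psiK; apply/forallP => i; rewrite swap2E.
  by case: eqP => [->|].
rewrite /sign /order_sign /=.
have imp1 :
    (psi (swap k z).1, psi (swap k z).2) \in L -> (psi z.1, psi z.2) \in L.
  by move=> h; exact: (tr _ _ _ (ext _ _ le1) (tr _ _ _ h (ext _ _ le2))).
have imp2 :
    (psi z.2, psi z.1) \in L -> (psi (swap k z).2, psi (swap k z).1) \in L.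
  by move=> h; exact: (tr _ _ _ (ext _ _ le2) (tr _ _ _ h (ext _ _ le1))).
by apply: lerB; rewrite lez_nat;
  [move/implyP: imp1|move/implyP: imp2]; do 2 case: (_ \in L).
Qed.

Lemma order_sign_diff0 L z : #|diff z| = 0%N -> sign L z = 0.
Proof. by move/cards0_eq/diff_eq0 => e; rewrite /sign /order_sign /= e subrr. Qed.

(** Points that differ in a single coordinate are comparable, so every linear extension orders them
    as [Q] does. *)
Lemma order_sign_diff1 L1 L2 z :
    linear_extension L1 -> linear_extension L2 -> #|diff z| == 1%N ->
  sign L1 z * sign L2 z = 1.
Proof.
move=> L1P L2P /cards1P[k zk].
have neq : psi z.1 <> psi z.2.
  move=> /(can_inj psiK) e; have : k \in diff z by rewrite zk set11.
  by rewrite inE e eqxx.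
have oth i : i != k -> z.1 i = z.2 i.
  by move=> ik; apply/eqP; have := in_set1 i k;
    rewrite -zk inE (negPf ik) => /negbFE.
have cmp : (psi z.1 <= psi z.2)%O \/ (psi z.2 <= psi z.1)%O.
  case/orP: (leq_total (z.1 k) (z.2 k)) => le; [left|right];
    rewrite phi_le !psiK; apply/forallP => i;
    by have [->|/oth ->] := eqVneq i k.
have S L : linear_extension L -> sign L z = (psi z.1 <= psi z.2)%O%:Z * 2 - 1.
  case/linear_extensionP => _ anti _ ext; rewrite /sign /order_sign /=.
  case: cmp => le; have Lz := ext _ _ le; rewrite Lz.
    rewrite le (_ : (_ \in L) = false) //.
    by apply/negP => h; apply: neq; apply: anti.
  rewrite (_ : (_ \in L) = false); last first.
    by apply/negP => h; apply: neq; apply: anti.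
  by case: (boolP (psi z.1 <= psi z.2)%O) => //
    /(conj le)/andP/le_anti e; case: neq.
by rewrite !S //; case: (psi z.1 <= psi z.2)%O.
Qed.

Lemma card_coordinates : #|Q| = N.
Proof. by rewrite (bij_eq_card (Bijective phiK psiK)) card_chain_prod. Qed.

Lemma sum_order_sign L1 L2 : linear_extension L1 -> linear_extension L2 ->
  \sum_p order_sign L1 p * order_sign L2 p =
    (\sum_k N * l k)%N%:Z + \sum_(z | (1 < #|diff z|)%N) sign L1 z * sign L2 z.
Proof.
move=> L1P L2P.
rewrite (reindex (fun z => (psi z.1, psi z.2))) /=; last first.
  by exists (fun p => (phi p.1, phi p.2)) => -[a b] _; rewrite /= ?phiK ?psiK.
rewrite (bigID (fun z => (1 < #|diff z|)%N)) /= addrC; congr (_ + _).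
rewrite -card_pairs_diff1 -[RHS]natz -sum1_card natr_sum.
rewrite big_mkcond [RHS]big_mkcond /=; apply: eq_bigr => z _; rewrite inE.
case: ifP => [|/negbFE z2]; last by rewrite gtn_eqF.
rewrite -leqNgt leq_eqVlt ltnS leqn0; case: ifP => [z1 _|_ /= /eqP z0].
  exact: order_sign_diff1.
by rewrite -/(sign L1 z) order_sign_diff0 // mul0r.
Qed.

Definition lex_extension (r : 'I_w -> nat) : {set Q * Q} :=
  [set p | lex_le r (phi p.1) (phi p.2)].

Lemma lex_extensionP r : injective r -> linear_extension (lex_extension r).
Proof.
move=> r_inj; apply/linear_extensionP; split=> [a b|a b|a b c|a b].
- by rewrite !inE lex_le_total.
- by rewrite !inE => h h'; apply: (can_inj phiK); apply: lex_le_anti h h'.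
- by rewrite !inE; apply: lex_le_trans.
- by rewrite phi_le inE; apply: lex_le_pointwise.
Qed.

Lemma diameter_chain_prod :
  4 * (linear_extension_diameter Q)%:Z
    = N%:Z ^+ 2 - N%:Z - (\sum_k N * l k)%N%:Z.
Proof.
have ub (L1 L2 : {set Q * Q}) : linear_extension L1 -> linear_extension L2 ->
    4 * #|reversed_pairs L1 L2|%:Z <= N%:Z ^+ 2 - N%:Z - (\sum_k N * l k)%N%:Z.
  move=> L1P L2P; rewrite reversed_pairs_order_sign // sum_order_sign //.
  rewrite card_coordinates opprD addrA gerBl.
  (* Exchanges preserve [diff], so the correlation inequality applies to the sum restricted to pairs
     with at least two differing coordinates. *)
  apply: sum_antisymmetric_ge0; try exact: order_sign_monotone.
    by move=> k z; rewrite diff_swap.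
  exact: order_sign_flip.
pose L1 := lex_extension (@nat_of_ord w).
pose L2 := lex_extension (fun i : 'I_w => (w - i)%N).
have L1P : linear_extension L1 := lex_extensionP val_inj.
have L2P : linear_extension L2 := lex_extensionP (@rev_rank_inj w).
have eq12 : 4 * #|reversed_pairs L1 L2|%:Z
    = N%:Z ^+ 2 - N%:Z - (\sum_k N * l k)%N%:Z.
  have sum0 : \sum_(z | (1 < #|diff z|)%N) sign L1 z * sign L2 z = 0.
    rewrite -[RHS](sum_lex_sign_eq0 l).
    by apply: eq_bigr => z _; rewrite /sign /order_sign !inE /= !psiK.
  rewrite reversed_pairs_order_sign // sum_order_sign // card_coordinates.
  by rewrite sum0 addr0.
rewrite -eq12; congr (4 * Posz _); apply/eqP; rewrite eqn_leq; apply/andP; split.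
  apply/bigmax_leqP => M1 M1P; apply/bigmax_leqP => M2 M2P.
  by have := ub _ _ M1P M2P; rewrite -eq12; lia.
apply: leq_trans (leq_bigmax_cond _ L1P).
exact: (leq_bigmax_cond (F := fun L => #|reversed_pairs L1 L|) _ L2P).
Qed.

End Diameter.

(** * Downsets of a disjoint union of chains as points of a product of chains *)

Section DownsetCoordinates.
Context (d : Order.disp_t) (P : finPOrderType d) (w : nat).
Variables (C : 'I_w -> {set P}) (l : 'I_w -> nat).
Hypothesis C_cover : \bigcup_(i < w) C i = [set: P].
Hypothesis C_disjoint : forall i j : 'I_w, i != j -> [disjoint C i & C j].
Hypothesis C_chain : forall (i : 'I_w) (x y : P),
  x \in C i -> y \in C i -> (x <= y)%O || (y <= x)%O.
Hypothesis C_incomparable : forall (i j : 'I_w) (x y : P),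
  i != j -> x \in C i -> y \in C j -> ~~ (x <= y)%O.
Hypothesis C_card : forall i : 'I_w, #|C i| = l i.

Implicit Types (A B : downset P) (x y : P).

Lemma downsetP A x y : (y <= x)%O -> x \in downset_val A -> y \in downset_val A.
Proof.
case: A => A /= dA yx xA; have := forallP dA x.
by rewrite xA => /forallP/(_ y); rewrite yx.
Qed.

Lemma chain_of x : exists i, x \in C i.
Proof. by have := in_setT x; rewrite -C_cover => /bigcupP[i _ ?]; exists i. Qed.

(** If [x] lies in [A] and [C i] but not in [B], no element of [B] is above [x]; so all elements of
    [B] in the chain lie below [x], hence in [A]. *)
Lemma downset_chain_total A B i :
  (downset_val A :&: C i \subset downset_val B) ||
  (downset_val B :&: C i \subset downset_val A).
Proof.
apply/orP; case: (boolP (_ \subset downset_val B)) => [|/subsetPn[x]]; first by left.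
rewrite inE => /andP[xA xi] xB; right; apply/subsetP => y; rewrite inE => /andP[yB yi].
case/orP: (C_chain xi yi) => h; last exact: downsetP h xA.
by rewrite (downsetP h yB) in xB.
Qed.

Lemma downset_chain_card A i : (#|downset_val A :&: C i| < (l i).+1)%N.
Proof. by rewrite ltnS -C_card subset_leq_card ?subsetIr. Qed.

(** A downset meets each chain in an initial segment, which its cardinality determines. *)
Definition coordinates A : chain_prod l :=
  [ffun i => Ordinal (downset_chain_card A i)].

Lemma coordinates_le A B : (A <= B)%O = chain_prod_le (coordinates A) (coordinates B).
Proof.
rewrite downset_leE; apply/idP/forallP => [sAB i|h].
  by rewrite !ffunE /= subset_leq_card ?setSI.
apply/subsetP => x xA; have [i xi] := chain_of x.
have := h i; rewrite !ffunE /= => card_le.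
case/orP: (downset_chain_total A B i) => [/subsetP|sBA]; first by apply; rewrite inE xA.
have /eqP e : downset_val B :&: C i == downset_val A :&: C i.
  by rewrite eqEcard card_le subsetI sBA subsetIr.
have : x \in downset_val A :&: C i by rewrite inE xA.
by rewrite -e inE => /andP[].
Qed.

Lemma coordinates_inj : injective coordinates.
Proof.
move=> A B e; apply: le_anti; rewrite !coordinates_le e andbb.
by apply/forallP.
Qed.

Let chain_seq i := sort <=%O (enum (C i)).

Lemma chain_seq_sorted i : sorted <=%O (chain_seq i).
Proof.
(* The order is total only on the chain, hence the relativized sorting lemma. *)
apply: (@sort_sorted_in _ (mem (C i))); first exact: C_chain.
by apply/allP => x; rewrite mem_enum.
Qed.

Lemma mem_chain_seq i x : (x \in chain_seq i) = (x \in C i).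
Proof. by rewrite mem_sort mem_enum. Qed.

Definition prefix_set (c : chain_prod l) : {set P} :=
  [set x | [exists i, x \in take (c i) (chain_seq i)]].

(** Incomparability of distinct chains forces [y] into the chain of [x], and sortedness then places
    [y] no later than [x]. *)
Lemma prefix_set_downset c : is_downset (prefix_set c).
Proof.
apply/forallP => x; apply/implyP; rewrite inE => /existsP[i xi].
apply/forallP => y; apply/implyP => yx; rewrite inE; apply/existsP; exists i.
have xs := mem_take xi; have xC : x \in C i by rewrite -mem_chain_seq.
have yC : y \in C i.
  have [j yj] := chain_of y; have [<-//|ji] := eqVneq j i.
  by move: (C_incomparable ji yj xC); rewrite yx.
have ys : y \in chain_seq i by rewrite mem_chain_seq.
move: xi; rewrite !in_take //; apply: leq_ltn_trans; rewrite leqNgt; apply/negP => lt.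
have xy := sorted_ltn_index le_trans (chain_seq_sorted i) _ _ xs ys lt.
have e : x = y by apply: le_anti; rewrite xy yx.
by rewrite e ltnn in lt.
Qed.

Definition downset_of_coordinates c : downset P := Downset (prefix_set_downset c).

(** Disjointness ensures that only the prefix of chain [i] meets [C i], and [c i <= l i] gives that
    prefix exactly [c i] elements. *)
Lemma downset_of_coordinatesK : cancel downset_of_coordinates coordinates.
Proof.
move=> c; apply/ffunP => i; apply/val_inj; rewrite ffunE /=.
have -> : prefix_set c :&: C i = [set x in take (c i) (chain_seq i)].
  apply/setP => x; rewrite !inE; apply/andP/idP => [[/existsP[j xj] xi]|xi].
    have [-> //|ij] := eqVneq i j.
    have := disjointFr (C_disjoint ij) xi.
    by rewrite -mem_chain_seq (mem_take xj).
  by split; [apply/existsP; exists i | rewrite -mem_chain_seq (mem_take xi)].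
rewrite cardsE (card_uniqP _); last by rewrite take_uniq // sort_uniq enum_uniq.
rewrite size_takel // size_sort -cardE C_card.
by have := ltn_ord (c i); rewrite ltnS.
Qed.

(** A right inverse of an injective map is also a left inverse. *)
Lemma coordinatesK : cancel coordinates downset_of_coordinates.
Proof. by move=> A; apply: coordinates_inj; rewrite downset_of_coordinatesK. Qed.

End DownsetCoordinates.

Theorem theorem7 (d : Order.disp_t) (P : finPOrderType d) (w : nat)
    (C : 'I_w -> {set P}) (l : 'I_w -> nat)
    (C_cover : \bigcup_(i < w) C i = [set: P])
    (C_disjoint : forall i j : 'I_w, i != j -> [disjoint C i & C j])
    (C_chain : forall (i : 'I_w) (x y : P),
        x \in C i -> y \in C i -> (x <= y)%O || (y <= x)%O)
    (C_incomparable : forall (i j : 'I_w) (x y : P),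
        i != j -> x \in C i -> y \in C j -> ~~ (x <= y)%O)
    (C_card : forall i : 'I_w, #|C i| = l i) :
  (linear_extension_diameter (downset P))%:R =
    1 / 4 * ((\prod_(i < w) ((l i)%:R + 1)) ^+ 2
             - \sum_(k < w) ((l k)%:R + 1) * (l k)%:R
                 * \prod_(i < w | i != k) ((l i)%:R + 1)
             - \prod_(i < w) ((l i)%:R + 1)) :> rat.
Proof.
have := diameter_chain_prod
  (coordinatesK C_cover C_disjoint C_chain C_incomparable C_card)
  (downset_of_coordinatesK C_cover C_disjoint C_chain C_incomparable C_card)
  (coordinates_le C_cover C_chain C_card).
set D := linear_extension_diameter _; set N := (\prod_i _)%N => e.
have NE : \prod_(i < w) ((l i)%:R + 1) = N%:R :> rat.
  by rewrite natr_prod; apply: eq_bigr => i _; rewrite natr1.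
have SE : \sum_(k < w) ((l k)%:R + 1) * (l k)%:R
    * \prod_(i < w | i != k) ((l i)%:R + 1) = (\sum_k N * l k)%N%:R :> rat.
  rewrite natr_sum; apply: eq_bigr => k _.
  (* The factor for [k] completes the product over [i != k] to [N]. *)
  by rewrite natrM -NE [in RHS](bigD1 k) //= mulrAC.
rewrite {}NE {}SE.
move/(congr1 (fun n : int => n%:~R : rat)): e.
rewrite !(rmorphM, rmorphB, rmorphXn) /= -!pmulrn => e.
by rewrite addrAC -e; field.
Qed.
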